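(* Let $A\subset\mathbb{Z}_c$ be a scale with $d$ elements, $1<d<c$, generated by some $f\in\mathbb{Z}_c$ which is not coprime with $c$. Put $m=\gcd(c,f)$ and $c'=c/m$. Then: \begin{itemize} \item if $A$ is a translate of $\{0,c/2\}$ (with $c$ even), then $A$ has exactly one generator; \item if $1<d<c'-1$, then $A$ has exactly two generators, and they are not coprime with $c$; \item if $d=c'$, i.e. $A$ is a regular polygon, then $A$ has exactly $\Phi(d)$ generators; \item if $d=c'-1$, then $A$ has exactly $\Phi(d+1)=\Phi(c')$ generators, and these generators all have the same order in the group $(\mathbb{Z}_c,+)$. \end{itemize}
   Context: $\mathbb{Z}_c=\mathbb{Z}/c\mathbb{Z}$ is the cyclic group with $c$ elements; for $f\in\mathbb{Z}_c$, $\gcd(c,f)$ is the gcd of $c$ with any integer representing $f$, and $f$ is coprime with $c$ if this gcd is $1$. $\Phi$ is Euler's totient function. A scale is a subset of $\mathbb{Z}_c$. A scale $A$ with $d$ elements is generated by $f\in\mathbb{Z}_c$ (and $f$ is a generator of $A$) if $A=\{a,a+f,a+2f,\dots,a+(d-1)f\}$ for some $a\in A$. The number of generators of $A$ is the number of distinct such $f\in\mathbb{Z}_c$. A regular polygon is a translate of a subgroup of $\mathbb{Z}_c$. *)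

(* Defs.v *)
From HB Require Import structures.
From mathcomp Require Import all_boot all_order all_algebra all_fingroup.

Set Implicit Arguments.
Unset Strict Implicit.
Unset Printing Implicit Defensive.

Import GRing.Theory.
Local Open Scope ring_scope.

(* 'Z_c is Z/cZ only for c > 1; the definitions below are meant for such c. *)

Definition translate (c : nat) (t : 'Z_c) (B : {set 'Z_c}) : {set 'Z_c} :=
  [set t + b | b in B].

Definition generated_by (c : nat) (A : {set 'Z_c}) (f : 'Z_c) : bool :=
  [exists a in A, A == [set a + f *+ (i : nat) | i : 'I_#|A|]].

Definition generators (c : nat) (A : {set 'Z_c}) : {set 'Z_c} :=
  [set f | generated_by A f].

(* The canonical finite group structure on 'Z_c is the additive one. *)
Definition regular_polygon (c : nat) (A : {set 'Z_c}) : Prop :=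
  exists (t : 'Z_c) (H : {group 'Z_c}), A = translate t H.

(* For f : 'Z_c, its coercion to nat is the representative in [0, c). *)
Definition gcdZ (c : nat) (f : 'Z_c) : nat := gcdn c f.

Definition coprimeZ (c : nat) (f : 'Z_c) : bool := gcdZ f == 1%N.

(* Main.v *)
Require Import Defs.
From HB Require Import structures.
From mathcomp Require Import all_boot all_order all_algebra all_fingroup.
From mathcomp Require Import cyclic zify.

(** A scale with d > 1 elements generated by f is an arithmetic progression of
    step f inside one coset of the subgroup <f>, and <f> has order
    n = c' = c / gcd(c, f) ([order_Zc]); since the d terms are distinct, d <= n.
    The crux is that every other generator g of A lives in the same subgroup:
    g is a difference of two elements of A, hence a multiple of f, and
    symmetrically f is a multiple of g, so that <f> = <g>
    ([same_cycle_generators]).  In particular all generators have the same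
    order n, and as n determines gcd(c, g), none of them is coprime with c.
    It remains to see which generators of the cyclic group <f> generate A; only
    the length of A matters.

    - If d = n, then A is a full coset of <f>, a description that only mentions
      the subgroup: all Phi(n) generators of <f> work ([progression_order],
      [card_generators_totient]).  Conversely, if A is a coset of a subgroup H,
      then H contains the difference f, hence <f>, so n <= d
      ([regular_polygonP]).  A translate of {0, c/2} is the case d = 2, where
      Phi(2) = 1.
    - If d = n - 1, then A is a coset of <f> minus a point, which again only
      depends on <f> ([progression_order_pred]).
    - If d < n - 1, then translation by a generator moves a single element of A
      out of A, namely the last term of the progression
      ([progression_last]), whereas translation by k f with k different from
      0, 1 and -1 modulo n moves out at least two ([step_unique_up_to_sign]).  So the
      generators are f and -f, which differ because n > 2. *)

Set Implicit Arguments.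
Unset Strict Implicit.
Unset Printing Implicit Defensive.

Import GRing.Theory.
Import FinRing.Theory.
Local Open Scope ring_scope.

Definition progression (V : finZmodType) (a f : V) (d : nat) : {set V} :=
  [set a + f *+ (i : nat) | i : 'I_d].

Lemma progressionP (V : finZmodType) (a f : V) d x :
  reflect (exists2 i, (i < d)%N & x = a + f *+ i) (x \in progression a f d).
Proof.
apply: (iffP imsetP) => [[i _ ->]|[i i_lt_d ->]]; first by exists i.
by exists (Ordinal i_lt_d).
Qed.

Lemma eq_mulrn_order (V : finZmodType) (f : V) i j :
  (i < #[f]%g)%N -> (j < #[f]%g)%N -> (f *+ i == f *+ j) = (i == j).
Proof. by move=> ? ?; rewrite -!zmodXgE eq_expg_mod_order !modn_small. Qed.

Lemma mem_progression (V : finZmodType) (a f : V) d i :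
    (d <= #[f]%g)%N -> (i < #[f]%g)%N ->
  (a + f *+ i \in progression a f d) = (i < d)%N.
Proof.
move=> d_le i_lt; apply/progressionP/idP => [[j j_lt /addrI/eqP]|]; last by exists i.
by rewrite eq_mulrn_order ?(leq_trans j_lt) // => /eqP->.
Qed.

(** Beyond the order of the step the terms repeat, so pairwise distinct terms
    force a bound on the length. *)
Lemma card_progression_leq (V : finZmodType) (a f : V) d :
  #|progression a f d| = d -> (d <= #[f]%g)%N.
Proof.
move=> card_d; rewrite -card_d.
have -> : #[f]%g = #|'I_(#[f]%g)| by rewrite card_ord.
apply: leq_trans (leq_imset_card (fun i : 'I__ => a + f *+ i) _).
apply/subset_leq_card/subsetP => x /progressionP[i _ ->].
apply/progressionP; exists (i %% #[f]%g)%N; first by rewrite ltn_mod order_gt0.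
by rewrite -[in RHS]zmodXgE expg_mod_order.
Qed.

Lemma progression_rev (V : finZmodType) (a f : V) d :
  progression a f d = progression (a + f *+ d.-1) (- f) d.
Proof.
have sub (b g : V) : progression b g d \subset progression (b + g *+ d.-1) (- g) d.
  apply/subsetP => x /progressionP[i i_lt ->]; apply/progressionP.
  exists (d.-1 - i)%N; first lia.
  rewrite mulNrn -addrA -mulrnBr; last lia.
  by congr (_ + _ *+ _); lia.
apply/eqP; rewrite eqEsubset sub /=.
by have := sub (a + f *+ d.-1) (- f); rewrite mulNrn addrK opprK.
Qed.

(** The only way out of a progression by its own step is from its last term;
    this characterizes the exit point by the set and the step alone. *)
Lemma progression_last (V : finZmodType) (a f : V) d x :
    x \in progression a f d -> x + f \notin progression a f d ->
  x = a + f *+ d.-1.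
Proof.
case/progressionP=> i i_lt -> xf_out.
suff -> : i = d.-1 by [].
have [//|i_neq] := eqVneq i d.-1; case/negP: xf_out.
by apply/progressionP; exists i.+1; [lia|rewrite mulrSr addrA].
Qed.

(** The step f is the difference of the first two terms, and differences of
    elements of a progression of step g are multiples of g. *)
Lemma step_in_cycle (V : finZmodType) (a b f g : V) d :
  (1 < d)%N -> progression a f d = progression b g d -> f \in <[g]>%g.
Proof.
move=> d_gt1 eq_fg.
have in_bg i : (i < d)%N -> exists j, a + f *+ i = b + g *+ j.
  move=> i_lt; have: a + f *+ i \in progression a f d.
    by apply/progressionP; exists i.
  by rewrite eq_fg => /progressionP[j _]; exists j.
have [|j] := in_bg 0%N; first lia; rewrite addr0 => def_a.
have [//|k] := in_bg 1%N; rewrite mulr1n => def_af.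
suff -> : f = (g ^+ k * (g ^+ j)^-1)%g by rewrite groupM ?groupV ?mem_cycle.
have -> : f = (a + f) - a by rewrite addrC addKr.
by rewrite def_af def_a opprD addrACA subrr add0r.
Qed.

Lemma same_cycle (V : finZmodType) (a b f g : V) d :
  (1 < d)%N -> progression a f d = progression b g d -> <[f]>%g = <[g]>%g.
Proof.
move=> d_gt1 eq_fg; apply/eqP; rewrite eqEsubset !cycle_subG.
by rewrite (step_in_cycle d_gt1 eq_fg) (step_in_cycle d_gt1 (esym eq_fg)).
Qed.

(** Write g = k f.  By [progression_last] only one term a + i f, with i < d,
    leaves the set under translation by g.  But if 2 <= k <= n - 2, where n is
    the order of f, two consecutive indices i have i + k in the complementary
    range [d, n - 1]: this uses that both d and n - d are at least 2. *)
Lemma step_unique_up_to_sign (V : finZmodType) (a b f g : V) d :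
    (1 < d)%N -> (d.+1 < #[f]%g)%N ->
  progression a f d = progression b g d -> g = f \/ g = - f.
Proof.
move=> d_gt1 d_lt eq_fg; have [n def_n] : exists n, #[f]%g = n by exists #[f]%g.
rewrite def_n in d_lt.
have [k k_lt def_g] : exists2 k, (k < n)%N & g = f *+ k.
  by have /cyclePmin[k] := step_in_cycle d_gt1 (esym eq_fg); rewrite def_n; exists k.
have fn0 : f *+ n = 0 by rewrite -def_n -zmodXgE expg_order.
have [k1|k_neq1] := eqVneq k 1%N; first by left; rewrite def_g k1.
have [k_n1|k_neqn1] := eqVneq k n.-1.
  right; apply/eqP; rewrite -addr_eq0 def_g k_n1 -mulrSr prednK ?fn0 //; lia.
have k_neq0 : k != 0%N.
  apply/eqP => k0; have := same_cycle d_gt1 eq_fg.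
  move/(congr1 (fun B : {set V} => #|B|)); rewrite /= -!orderE.
  by rewrite def_g k0 mulr0n (order1 V) def_n; lia.
have exits i l : (i < d)%N -> (d <= l < n)%N -> (i + k)%N = l ->
    f *+ i = b + g *+ d.-1 - a.
  move=> i_lt /andP[d_le_l l_lt] def_l.
  have <- : a + f *+ i = b + g *+ d.-1; last by rewrite addrC addKr.
  apply: progression_last; rewrite -eq_fg; first by rewrite mem_progression; lia.
  by rewrite def_g -addrA -mulrnDr def_l mem_progression; lia.
suff [i [j [i_neq_j i_lt j_lt eq_ij]]] :
    exists i j, [/\ i != j, (i < d)%N, (j < d)%N & f *+ i = f *+ j].
  by move/eqP: eq_ij; rewrite eq_mulrn_order ?(negPf i_neq_j) //; lia.
have [k_small|k_big] := leqP k (n - d).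
  (* The last two terms land between d and n - 1. *)
  exists d.-1, d.-2; split; [lia..|].
  by rewrite (@exits _ (d.-1 + k)%N) ?(@exits _ (d.-2 + k)%N) //; lia.
(* A longer jump would wrap around; take instead the terms that land on the
   last two places n - 1 and n - 2 of the coset. *)
exists (n.-1 - k)%N, (n.-2 - k)%N; split; [lia..|].
by rewrite (@exits _ n.-1) ?(@exits _ n.-2) //; lia.
Qed.

Lemma progression_order (V : finZmodType) (a f : V) :
  progression a f #[f]%g = [set a + h | h in <[f]>%g].
Proof.
apply/setP => x; apply/progressionP/imsetP => [[i _ ->]|[h /cyclePmin[i i_lt ->] ->]].
  by exists (f *+ i); rewrite // -zmodXgE mem_cycle.
by exists i.
Qed.

(** Starting one step after p, the progression visits the whole coset of p
    except p itself, where it would arrive next. *)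
Lemma progression_order_pred (V : finZmodType) (p f : V) :
  progression (p + f) f #[f]%g.-1 = [set p + h | h in <[f]>%g] :\ p.
Proof.
have n_gt0 := order_gt0 f.
apply/setP => x; rewrite in_setD1 -progression_order.
apply/progressionP/andP => [[i i_lt ->]|[x_neq /progressionP[i i_lt def_x]]].
  rewrite -addrA -mulrS; split; last by apply/progressionP; exists i.+1; first lia.
  rewrite -[X in _ != X]addr0 (inj_eq (addrI p)) -[X in _ != X](mulr0n f).
  by rewrite eq_mulrn_order; lia.
case: i => [|i] in i_lt def_x; first by rewrite def_x addr0 eqxx in x_neq.
by exists i; [lia | rewrite -addrA -mulrS].
Qed.

(** For a nonempty scale, the requirement that the starting point be an element
    of the scale is automatic. *)
Lemma generatorsP c (A : {set 'Z_c}) g : A != set0 ->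
  reflect (exists a, A = progression a g #|A|) (g \in generators A).
Proof.
move=> A_neq0; rewrite inE; apply: (iffP existsP) => [[a /andP[_ /eqP ?]]|[a def_A]].
  by exists a.
exists a; apply/andP; split; last exact/eqP.
by rewrite def_A; apply/progressionP; exists 0%N; rewrite ?addr0 // card_gt0.
Qed.

Lemma same_cycle_generators c (A : {set 'Z_c}) f g : (1 < #|A|)%N ->
    f \in generators A -> g \in generators A -> <[f]>%g = <[g]>%g.
Proof.
move=> A_gt1; have A_neq0 : A != set0 by rewrite -card_gt0; lia.
case/(generatorsP _ A_neq0)=> a def_af /(generatorsP _ A_neq0)[b def_bg].
exact: same_cycle A_gt1 (etrans (esym def_af) def_bg).
Qed.

Lemma order_Zc c (f : 'Z_c) : (1 < c)%N -> #[f]%g = (c %/ gcdZ f)%N.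
Proof.
move=> c_gt1; rewrite /gcdZ -{1}(natr_Zp f) -zmodXgE orderXgcd.
by rewrite order_Zp1; move: (nat_of_ord f) => k; rewrite Zp_cast.
Qed.

(** Generators of a scale all span <f>, so their number is maximal as soon as
    the scale depends on its step only through the subgroup it spans. *)
Lemma card_generators_totient c (A : {set 'Z_c}) f : (1 < #|A|)%N ->
    f \in generators A ->
    (forall g, <[g]>%g = <[f]>%g -> g \in generators A) ->
  #|generators A| = totient #[f]%g.
Proof.
move=> A_gt1 genAf all_gen; rewrite totient_gen; apply: eq_card => g.
rewrite [RHS]inE /generator eq_sym.
apply/idP/eqP => [genAg|/all_gen //]; exact: (same_cycle_generators A_gt1).
Qed.

(** A subgroup H having a translate equal to the progression contains the
    difference f of its first two terms, hence <f>, so the length of the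
    progression is at least the order of f. *)
Lemma regular_polygonP c (a f : 'Z_c) d :
    (1 < d)%N -> #|progression a f d| = d ->
  d = #[f]%g <-> regular_polygon (progression a f d).
Proof.
move=> d_gt1 card_d; split=> [->|[t [H def_A]]].
  by exists a, <[f]>%G; rewrite progression_order.
apply/eqP; rewrite eqn_leq (card_progression_leq card_d) /=.
have -> : d = #|H| by rewrite -card_d def_A card_imset //; apply: addrI.
apply: subset_leq_card; rewrite cycle_subG.
have inH i : (i < d)%N -> exists2 h, h \in H & a + f *+ i = t + h.
  move=> i_lt; apply/imsetP; rewrite -[imset _ _]/(translate t H) -def_A.
  by apply/progressionP; exists i.
have [|h hH] := inH 0%N; first lia; rewrite addr0 => def_a.
have [//|k kH] := inH 1%N; rewrite mulr1n def_a -addrA => /addrI def_k.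
by rewrite -(addKr h f) def_k -zmodVgE -zmodMgE groupM ?groupV.
Qed.

Theorem theorem3 (c d : nat) (A : {set 'Z_c}) (f : 'Z_c)
  (cardA : #|A| = d) (d_gt1 : (1 < d)%N) (d_ltc : (d < c)%N)
  (genA : generated_by A f) (fNcop : ~~ coprimeZ f) :
  let m := gcdZ f in
  let c' := (c %/ m)%N in
  [/\ (~~ odd c ->
        (exists t : 'Z_c, A = translate t [set 0; (c %/ 2)%:R]) ->
        #|generators A| = 1%N),
      ((d < c' - 1)%N ->
        #|generators A| = 2%N /\
        (forall g : 'Z_c, g \in generators A -> ~~ coprimeZ g)),
      ((d = c' <-> regular_polygon A) /\
        (d = c' -> #|generators A| = totient d)) &
      (d = (c' - 1)%N ->
        [/\ #|generators A| = totient (d + 1),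
            totient (d + 1) = totient c' &
            forall g h : 'Z_c, g \in generators A -> h \in generators A ->
              #[g]%g = #[h]%g])].
Proof.
move=> m c'.
have c_gt1 : (1 < c)%N by lia.
have def_c' : c' = #[f]%g by rewrite order_Zc.
have A_gt1 : (1 < #|A|)%N by rewrite cardA.
have A_neq0 : A != set0 by rewrite -card_gt0; lia.
have gen_f : f \in generators A by rewrite inE.
have /(generatorsP _ A_neq0)[a] := gen_f; rewrite cardA => def_A.
have gen_order g : g \in generators A -> #[g]%g = #[f]%g.
  by move=> gen_g; rewrite !orderE (same_cycle_generators A_gt1 gen_g gen_f).
have d_le : (d <= #[f]%g)%N.
  by apply: (@card_progression_leq _ a); rewrite -def_A.
have polygonP : d = c' <-> regular_polygon A.
  by rewrite def_c' def_A; apply: regular_polygonP; rewrite // -def_A.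
have polygon_gen : d = c' -> #|generators A| = totient d.
  move=> d_c'; rewrite d_c' def_c'; apply: card_generators_totient => // g eq_gf.
  apply/generatorsP => //; exists a.
  rewrite cardA def_A d_c' def_c' [in RHS]orderE -eq_gf -orderE.
  by rewrite !progression_order eq_gf.
split; [|move=> d_lt|by []|move=> d_c'].
- move=> c_even [t def_At].
  (* The pair {0, h} is the subgroup of order 2 spanned by h, which makes A a
     regular polygon with two elements. *)
  set h : 'Z_c := (c %/ 2)%:R in def_At.
  have card_A : d = (0 != h).+1.
    by rewrite -cardA def_At card_imset ?cards2 //; apply: addrI.
  have h_neq0 : h != 0 by rewrite eq_sym; move: d_gt1; rewrite card_A; case: eqP.
  have order_h : #[h]%g = 2%N.
    apply: nt_prime_order => //; rewrite zmodXgE -mulrnA divnK ?dvdn2 //.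
    exact: pchar_Zp.
  have d2 : d = 2%N by rewrite card_A eq_sym h_neq0.
  rewrite polygon_gen; first by rewrite d2.
  by apply/polygonP; exists t, <[h]>%G; rewrite def_At /= cycle2g.
- have d_ltf : (d.+1 < #[f]%g)%N by lia.
  have gens : generators A = [set f; - f].
    apply/setP => g; apply/(generatorsP _ A_neq0)/set2P => [[b]|].
      by rewrite cardA def_A; apply: step_unique_up_to_sign.
    rewrite cardA => -[->|->]; first by exists a.
    by rewrite def_A progression_rev; exists (a + f *+ d.-1).
  split=> [|g /gen_order].
    rewrite gens cards2 -addr_eq0 -mulr2n -zmodXgE -zmod1gE -order_dvdn.
    by rewrite gtnNdvd // (leq_ltn_trans d_gt1 (ltnW d_ltf)).
  rewrite order_Zc // -def_c' /c' /coprimeZ => eq_order.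
  apply: contra fNcop => /eqP g_cop; move: eq_order; rewrite g_cop divn1 => eq_c.
  (* Here c = c / m, which is impossible for a divisor m > 1 of c. *)
  have := divnK (dvdn_gcdl c f : (m %| c)%N).
  by rewrite -eq_c -[RHS]muln1 => /eqP; rewrite eqn_pmul2l //; lia.
- have d_f : d = #[f]%g.-1 by lia.
  split=> [||g h /gen_order-> /gen_order-> //]; last by congr totient; lia.
  have -> : (d + 1)%N = #[f]%g by lia.
  apply: card_generators_totient => // g eq_gf.
  have eq_order : #[g]%g = #[f]%g by rewrite !orderE eq_gf.
  (* The missing point of the coset is a - f, whatever the step. *)
  apply/generatorsP => //; exists (a - f + g).
  rewrite cardA d_f -eq_order progression_order_pred eq_gf.
  by rewrite -progression_order_pred subrK -d_f.
Qed.
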